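(* Let $G$ be a finitely generated group. Then, for all $k\ge1$, $$\mathcal{V}_k(G)=\mathrm{supp}\Big(\bigwedge^k\big(B(G)\otimes\mathbb{C}\big)\Big),$$ at least away from the identity $1\in\mathbb{T}_G$; that is, the two subsets of $\mathbb{T}_G$ have the same intersection with $\mathbb{T}_G\setminus\{1\}$.
   Context: $\mathbb{T}_G=\mathrm{Hom}(G,\mathbb{C}^* )$ is the character group, identified with the maximal spectrum of $\mathbb{C}[G_{\mathrm{ab}}]$, where $G_{\mathrm{ab}}=G/G'$, $G'=[G,G]$. For $k\ge1$, $\mathcal{V}_k(G)=\{\rho\in\mathbb{T}_G:\dim_{\mathbb{C}}H_1(G,\mathbb{C}_\rho)\ge k\}$, where $\mathbb{C}_\rho$ is $\mathbb{C}$ with $G$-action via $\rho$. The Alexander invariant $B(G)=G'/G''$ ($G''=[G',G']$) is a $\mathbb{Z}[G_{\mathrm{ab}}]$-module via conjugation, so $B(G)\otimes\mathbb{C}$ is a $\mathbb{C}[G_{\mathrm{ab}}]$-module; the exterior power is taken over $\mathbb{C}[G_{\mathrm{ab}}]$. The support $\mathrm{supp}(M)$ of an $R$-module $M$ is the set of maximal ideals $\mathfrak{m}$ of $R$ with $M_{\mathfrak{m}}\ne0$. *)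

(* Defs.v *)
From HB Require Import structures.
From mathcomp Require Import all_boot all_order all_algebra finmap.
From mathcomp Require Import boolp classical_sets reals.
From mathcomp Require Import complex monalg ring.

Set Implicit Arguments.
Unset Strict Implicit.
Unset Printing Implicit Defensive.

Import Order.TTheory GRing.Theory Num.Theory.

Local Open Scope ring_scope.
Local Open Scope quotient_scope.

HB.lock Definition fsum (K : choiceType) (A V : zmodType) (F : K -> A -> V)
    (p : {malg A[K]}) : V := \sum_(k <- msupp p) F k p@_k.

Section FormalSums.
Variables (K : choiceType) (A V : zmodType).
Implicit Types (p q : {malg A[K]}).

Lemma fsumE (F : K -> A -> V) p : fsum F p = \sum_(k <- msupp p) F k p@_k.
Proof. by rewrite unlock. Qed.

Variable F : K -> {additive A -> V}.

Lemma fsumEw p (d : {fset K}) : (msupp p `<=` d)%fset ->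
  fsum F p = \sum_(k <- d) F k p@_k.
Proof.
move=> le_pd; rewrite fsumE (big_fset_incl _ le_pd) //= => k _.
by move/mcoeff_outdom ->; rewrite raddf0.
Qed.

Lemma fsum_is_zmod_morphism : zmod_morphism (fsum F).
Proof.
move=> p q; pose d := (msupp p `|` msupp q)%fset.
rewrite (@fsumEw (p - q) d) ?msuppB_le // (@fsumEw p d) ?fsubsetUl //.
rewrite (@fsumEw q d) ?fsubsetUr // -sumrB; apply: eq_bigr => k _.
by rewrite mcoeffB raddfB.
Qed.

Lemma fsumU k a : fsum F << a *g k >> = F k a.
Proof. by rewrite (fsumEw msuppU_le) big_seq_fset1 mcoeffUU. Qed.

End FormalSums.

Lemma malg_ind (K : choiceType) (A : zmodType) (P : {malg A[K]} -> Prop) :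
  P 0 -> (forall a k, P << a *g k >>) -> (forall p q, P p -> P q -> P (p + q)) ->
  forall p, P p.
Proof. by move=> P0 PU PD p; rewrite [p]monalgE; elim/big_ind: _. Qed.

Section LinearExtension.
Variables (K : choiceType) (R : comNzRingType) (V : lmodType R).

Definition lext (f : K -> V) (p : {malg R[K]}) : V :=
  fsum (fun k c => c *: f k) p.

Variable f : K -> V.

Fact scale_is_zmod_morphism k : zmod_morphism (fun c : R => c *: f k).
Proof. by move=> a b; rewrite scalerBl. Qed.

Let F k : {additive R -> V} :=
  HB.pack (fun c : R => c *: f k)
    (GRing.isZmodMorphism.Build R V _ (scale_is_zmod_morphism k)).

Lemma lext_is_zmod_morphism : zmod_morphism (lext f).
Proof. exact: (fsum_is_zmod_morphism F). Qed.

HB.instance Definition _ :=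
  GRing.isZmodMorphism.Build {malg R[K]} V (lext f) lext_is_zmod_morphism.

Lemma lextU c k : lext f << c *g k >> = c *: f k.
Proof. exact: (fsumU F). Qed.

Lemma lext_is_scalable : scalable (lext f).
Proof.
move=> c p; rewrite /lext (fsumEw F (msuppZ_le c p)) fsumE scaler_sumr.
by apply: eq_bigr => k _; rewrite /= mcoeffZ scalerA.
Qed.

HB.instance Definition _ :=
  GRing.isScalable.Build R {malg R[K]} V *:%R (lext f) lext_is_scalable.

End LinearExtension.

Section ModuleQuotient.
Variables (R : pzRingType) (V : lmodType R).

Definition span (S : set V) : {pred V} := fun v =>
  `[< forall W : {pred V}, GRing.submod_closed W ->
        (forall s, S s -> s \in W) -> v \in W >].

Variable S : set V.

Lemma mem_span s : S s -> s \in span S.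
Proof. by move=> Ss; apply/asboolP => W _; apply. Qed.

Lemma span_min (W : {pred V}) : GRing.submod_closed W ->
  (forall s, S s -> s \in W) -> {subset span S <= W}.
Proof. by move=> W_submod SW v /asboolP; apply. Qed.

Lemma span_submod_closed : GRing.submod_closed (span S).
Proof.
split=> [|a u v /asboolP Su /asboolP Sv]; apply/asboolP => W clW SW.
  by case: clW.
by have [_ linW] := clW; apply: linW; [apply: Su | apply: Sv].
Qed.

HB.instance Definition _ :=
  GRing.isSubmodClosed.Build R V (span S)
    (GRing.submod_closed_semi span_submod_closed).

Definition lquot : Type := Quotient.quot (span S : zmodClosed V).

HB.instance Definition _ := GRing.Zmodule.on lquot.
HB.instance Definition _ := EqQuotient.on lquot.

Definition lproj (v : V) : lquot := \pi_lquot v.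

Lemma lprojP u v : lproj u = lproj v <-> u - v \in span S.
Proof.
have E := Quotient.idealrBE (span S : zmodClosed V) u v.
by rewrite E; split=> [|/eqP] // /eqP.
Qed.

Lemma reprlK (x : lquot) : lproj (repr x) = x. Proof. exact: reprK. Qed.

Lemma lproj_is_zmod_morphism : zmod_morphism lproj.
Proof. by move=> u v; rewrite /lproj raddfB. Qed.

HB.instance Definition _ :=
  GRing.isZmodMorphism.Build V lquot lproj lproj_is_zmod_morphism.

Definition lquot_scale (a : R) (x : lquot) : lquot := lproj (a *: repr x).

Lemma lquot_scaleE a v : lquot_scale a (lproj v) = lproj (a *: v).
Proof.
by apply/lprojP; rewrite -scalerBr rpredZ //; apply/lprojP; rewrite reprlK.
Qed.

Fact lquot_scaleA a b x :
  lquot_scale a (lquot_scale b x) = lquot_scale (a * b) x.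
Proof. by rewrite -[x]reprlK !lquot_scaleE scalerA. Qed.

Fact lquot_scale1 : left_id 1 lquot_scale.
Proof. by move=> x; rewrite -[x]reprlK !lquot_scaleE scale1r. Qed.

Fact lquot_scaleDr : right_distributive lquot_scale +%R.
Proof.
move=> a x y; rewrite -[x]reprlK -[y]reprlK -raddfD !lquot_scaleE.
by rewrite scalerDr raddfD.
Qed.

Fact lquot_scaleDl x : {morph lquot_scale^~ x : a b / a + b}.
Proof.
by move=> a b; rewrite -[x]reprlK !lquot_scaleE scalerDl raddfD.
Qed.

HB.instance Definition _ := GRing.Zmodule_isLmodule.Build R lquot
  lquot_scaleA lquot_scale1 lquot_scaleDr lquot_scaleDl.

Lemma lproj_is_scalable : scalable lproj.
Proof. by move=> a v; rewrite -lquot_scaleE. Qed.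

HB.instance Definition _ :=
  GRing.isScalable.Build R V lquot *:%R lproj lproj_is_scalable.

End ModuleQuotient.

Lemma span_morph (R : pzRingType) (V V' : lmodType R) (S : set V) (S' : set V')
    (h : {linear V -> V'}) :
  (forall s, S s -> h s \in span S') ->
  forall v, v \in span S -> h v \in span S'.
Proof.
move=> hS v Sv; pose W : {pred V} := fun v => h v \in span S'.
apply: (@span_min R V S W) => //; split=> [|a u w Wu Ww].
  by change (h 0 \in span S'); rewrite raddf0 rpred0.
by change (h (a *: u + w) \in span S'); rewrite linearP rpredD ?rpredZ.
Qed.

Section Tensor.
Variables A B : zmodType.

Definition tensor_rel : set {malg int[(A * B)%type]} := [set r |
     (exists a a' b, r = << (a + a', b) >> - << (a, b) >> - << (a', b) >>)
  \/ (exists a b b', r = << (a, b + b') >> - << (a, b) >> - << (a, b') >>)].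

Definition tensor : Type := lquot tensor_rel.

HB.instance Definition _ := GRing.Zmodule.on tensor.

Definition tpure (a : A) (b : B) : tensor := lproj tensor_rel << (a, b) >>.

Lemma tpureDl a a' b : tpure (a + a') b = tpure a b + tpure a' b.
Proof.
apply/eqP; rewrite -subr_eq0 opprD addrA -!raddfB; apply/eqP.
rewrite -(raddf0 (lproj tensor_rel)); apply/lprojP.
by rewrite subr0 mem_span //; left; exists a, a', b.
Qed.

Lemma tpureDr a b b' : tpure a (b + b') = tpure a b + tpure a b'.
Proof.
apply/eqP; rewrite -subr_eq0 opprD addrA -!raddfB; apply/eqP.
rewrite -(raddf0 (lproj tensor_rel)); apply/lprojP.
by rewrite subr0 mem_span //; right; exists a, b, b'.
Qed.

Lemma tensor_ind (P : tensor -> Prop) :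
  (forall a b, P (tpure a b)) -> (forall x, P x -> P (- x)) ->
  (forall x y, P x -> P y -> P (x + y)) -> forall x, P x.
Proof.
move=> PU PN PD x; rewrite -[x]reprlK.
have P0 : P 0 by rewrite -(subrr (tpure 0 0)); apply: PD (PN _ _).
elim/malg_ind: (repr x) => [|n [a b]|p q Pp Pq]; last 1 first.
- by rewrite raddfD; apply: PD.
- by rewrite raddf0.
have Pnat m : P (lproj tensor_rel << (m%:Z) *g (a, b) >>).
  elim: m => [|m IHm]; first by rewrite monalgU0 raddf0.
  by rewrite -addn1 PoszD monalgUD raddfD; apply: PD => //; exact: PU.
case: n => // m; rewrite NegzE monalgUN raddfN; exact/PN/Pnat.
Qed.

End Tensor.

(* f (x) g, meaningful when f and g are additive. *)
HB.lock Definition tensor_map (A B A' B' : zmodType) (f : A -> A') (g : B -> B')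
    (x : tensor A B) : tensor A' B' :=
  lproj (@tensor_rel A' B') (lext (fun k : A * B => << (f k.1, g k.2) >>)
    (repr x)).

Section TensorMap.
Variables (A B A' B' : zmodType) (f : A -> A') (g : B -> B').

Local Notation F := (lext (V := {malg int[(A' * B')%type]})
  (fun k : A * B => << (f k.1, g k.2) >>)).
Local Notation tensor_map := (tensor_map f g).

Fact tensor_mapF a b : F << (a, b) >> = << (f a, g b) >>.
Proof. by rewrite lextU scale1r. Qed.

Hypothesis fD : {morph f : a b / a + b}.
Hypothesis gD : {morph g : a b / a + b}.

Lemma tensor_mapE p :
  tensor_map (lproj (@tensor_rel A B) p) = lproj (@tensor_rel A' B') (F p).
Proof.
rewrite unlock.
apply/lprojP; rewrite -raddfB /=; set d := (X in lext _ X).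
have: d \in span (@tensor_rel A B) by apply/lprojP; rewrite reprlK.
move: d; apply: span_morph => _ [[a [a' [b ->]]]|[a [b [b' ->]]]];
  rewrite !raddfB /= !tensor_mapF mem_span //.
by left; exists (f a), (f a'), (g b); rewrite fD.
by right; exists (f a), (g b), (g b'); rewrite gD.
Qed.

Lemma tensor_map_pure a b : tensor_map (tpure a b) = tpure (f a) (g b).
Proof. by rewrite tensor_mapE tensor_mapF. Qed.

Lemma tensor_mapD : {morph tensor_map : x y / x + y}.
Proof.
move=> x y; rewrite -[x]reprlK -[y]reprlK -raddfD !tensor_mapE.
by rewrite !raddfD.
Qed.

Lemma tensor_map0 : tensor_map 0 = 0.
Proof. by rewrite -(raddf0 (lproj _)) tensor_mapE !raddf0. Qed.

Lemma tensor_mapN x : tensor_map (- x) = - tensor_map x.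
Proof. by apply/eqP; rewrite -addr_eq0 -tensor_mapD addNr tensor_map0. Qed.

End TensorMap.

Section ExteriorPower.
Variables (A : comNzRingType) (M : lmodType A) (k : nat).

Definition set_entry (x : {ffun 'I_k -> M}) (i : 'I_k) (m : M) :
    {ffun 'I_k -> M} :=
  [ffun j => if j == i then m else x j].

Definition ext_rel : set {malg A[{ffun 'I_k -> M}]} := [set r |
     (exists x i m m', r = << set_entry x i (m + m') >>
                           - << set_entry x i m >> - << set_entry x i m' >>)
  \/ (exists x i a m, r = << set_entry x i (a *: m) >>
                           - a *: << set_entry x i m >>)
  \/ (exists (x : {ffun 'I_k -> M}) i j, [/\ i != j, x i = x j & r = << x >>])].

Definition ext_power : lmodType A := lquot ext_rel.

End ExteriorPower.

Section Support.
Variable A : comNzRingType.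

(* idealr_closed includes 1 \notin m *)
Definition maximal_ideal (m : {pred A}) : Prop :=
  idealr_closed m /\
  forall n : {pred A}, idealr_closed n -> {subset m <= n} -> {subset n <= m}.

Record max_spec := MaxSpec {
  max_spec_pred : A -> bool;
  max_specP : maximal_ideal max_spec_pred
}.

Coercion max_spec_mem (m : max_spec) : {pred A} := max_spec_pred m.

Variable m : max_spec.

Lemma max_spec0 : 0 \in m. Proof. by case: (max_specP m) => -[]. Qed.
Lemma max_spec1 : 1 \notin m. Proof. by case: (max_specP m) => -[]. Qed.
Lemma max_specPl a u v : u \in m -> v \in m -> a * u + v \in m.
Proof. by case: (max_specP m) => -[_ _ cl] _; apply: cl. Qed.

Lemma max_spec_prime u v : u \notin m -> v \notin m -> u * v \notin m.
Proof.
move=> u'm v'm; apply/negP => uv_m.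
pose n : {pred A} := fun x => `[< exists r, x - r * u \in m >].
have mn : {subset m <= n}.
  by move=> x mx; apply/asboolP; exists 0; rewrite mul0r subr0.
have un : u \in n by apply/asboolP; exists 1; rewrite mul1r subrr max_spec0.
have n1 : 1 \in n.
  apply: contraT => n'1; case/negP: u'm; case: (max_specP m) => _; apply; last first.
  - exact: un.
  - exact: mn.
  split=> //; first exact/mn/max_spec0.
  move=> a x y /asboolP[r xr] /asboolP[s ys]; apply/asboolP; exists (a * r + s).
  rewrite mulrDl opprD -mulrA addrACA -mulrBr; exact: max_specPl.
have /asboolP[r] := n1; move=> m1; case/negP: v'm.
have -> : v = v * (1 - r * u) + (r * (u * v) + 0).
  by rewrite mulrBr mulr1 addr0 mulrA [v * _]mulrC subrK.
by apply: max_specPl => //; apply: max_specPl => //; apply: max_spec0.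
Qed.

Variable M : lmodType A.

Definition denom : Type := {s : A | s \notin m}.

HB.instance Definition _ := Choice.on denom.

Definition denom1 : denom := exist _ 1 max_spec1.

Definition loc_equiv (x y : (M * denom)%type) : bool :=
  `[< exists2 u, u \notin m & u *: (val y.2 *: x.1 - val x.2 *: y.1) = 0 >].

Fact loc_equiv_is_equiv : equiv_class_of loc_equiv.
Proof.
split=> [x|x y|y x z].
- by apply/asboolP; exists 1; rewrite ?max_spec1 // subrr scaler0.
- apply/asboolP/asboolP => -[u m'u E]; exists u => //;
    by rewrite -opprB scalerN E oppr0.
move=> /asboolP[u m'u Exy] /asboolP[v m'v Eyz]; apply/asboolP.
exists (u * v * val y.2).
  by rewrite !max_spec_prime //; apply: (valP y.2).
move: Exy Eyz; case: x y z => [x s] [y t] [z r] /=.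
set s' := val s; set t' := val t; set r' := val r => /eqP.
rewrite scalerBr subr_eq0 => /eqP Exy /eqP.
rewrite scalerBr subr_eq0 => /eqP Eyz.
rewrite scalerBr; apply/eqP; rewrite subr_eq0 !scalerA; apply/eqP.
have -> : u * v * t' * r' = v * r' * u * t' by ring.
have -> : u * v * t' * s' = u * s' * v * t' by ring.
rewrite -![in LHS]scalerA Exy -![in RHS]scalerA -Eyz !scalerA.
by congr (_ *: _); ring.
Qed.

Canonical loc_equiv_equiv := EquivRelPack loc_equiv_is_equiv.
Canonical loc_equiv_encModRel := defaultEncModRel loc_equiv.

(* Only the set of fractions is needed, to compare them with 0/1; the module
   structure is not built. *)
Definition localization : Type := {eq_quot loc_equiv}.

HB.instance Definition _ := Choice.on localization.

Definition frac (x : M) (s : denom) : localization :=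
  \pi_({eq_quot loc_equiv}) (x, s).

Lemma fracP x y s t : frac x s = frac y t <->
  exists2 u, u \notin m & u *: (val t *: x - val s *: y) = 0.
Proof.
by split=> [/eqmodP/asboolP|E] //; apply/eqmodP/asboolP.
Qed.

End Support.

(* frac 0 (denom1 m) is the zero of the localization. *)
Definition supp (A : comNzRingType) (M : lmodType A) : set (max_spec A) :=
  [set m | exists z : localization m M, z <> frac 0 (denom1 m)].

HB.lock Definition ga_mul (K : comNzRingType) (A : zmodType)
    (p q : {malg K[A]}) : {malg K[A]} :=
  lext (fun a => lext (fun b => << (a + b)%R >> : {malg K[A]}) q) p.

Section GroupAlgebra.
Variables (K : comNzRingType) (A : zmodType).

(* K[A], for an abelian group A written additively: the monomials multiply as
   << c *g a >> * << d *g b >> = << c * d *g a + b >>. *)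
Definition group_algebra : Type := {malg K[A]}.

HB.instance Definition _ := GRing.Lmodule.on group_algebra.

Implicit Types p q r : {malg K[A]}.

Definition ga_one : {malg K[A]} := << 0 >>.

Local Notation ga_mul := (@ga_mul K A).

Lemma ga_mulE p q :
  ga_mul p q = lext (fun a => lext (fun b => << (a + b)%R >> : {malg K[A]}) q) p.
Proof. by rewrite unlock. Qed.

Lemma ga_mulDl : left_distributive ga_mul +%R.
Proof. by move=> p q r; rewrite !ga_mulE raddfD. Qed.

Lemma ga_mulUU a b c d : ga_mul << c *g a >> << d *g b >> = << c * d *g a + b >>.
Proof.
rewrite !ga_mulE !lextU scalerA.
by apply/malgP => l; rewrite mcoeffZ !mcoeffU mulrnAr mulr1.
Qed.

Lemma ga_mul0 q : ga_mul 0 q = 0.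
Proof. by rewrite !ga_mulE raddf0. Qed.

Lemma ga_mulDr : right_distributive ga_mul +%R.
Proof.
move=> p q r; elim/malg_ind: p => [|c a|p p' IH IH']; first by rewrite !ga_mul0 addr0.
  by rewrite !ga_mulE !lextU raddfD scalerDr.
by rewrite !ga_mulDl IH IH' [LHS]addrACA.
Qed.

Lemma ga_mulC : commutative ga_mul.
Proof.
have mul0 p : ga_mul p 0 = 0.
  by apply/eqP; rewrite -(inj_eq (addrI (ga_mul p 0))) -ga_mulDr !addr0.
move=> p q; elim/malg_ind: p => [|c a|p p' IH IH'].
- by rewrite ga_mul0 mul0.
- elim/malg_ind: q => [|d b|q q' IH IH']; first by rewrite ga_mul0 mul0.
    by rewrite !ga_mulUU mulrC addrC.
  by rewrite ga_mulDl ga_mulDr IH IH'.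
by rewrite ga_mulDl ga_mulDr IH IH'.
Qed.

Lemma ga_mulA : associative ga_mul.
Proof.
move=> p q r; elim/malg_ind: p => [|c a|p p' IH IH'].
- by rewrite !ga_mul0.
- elim/malg_ind: q => [|d b|q q' IH IH'].
  + by rewrite ga_mulC !(ga_mul0, ga_mulC _ 0).
  + elim/malg_ind: r => [|e l|r r' IH IH'].
    * by rewrite !(ga_mulC _ 0) !ga_mul0 (ga_mulC _ 0) ga_mul0.
    * by rewrite !ga_mulUU mulrA addrA.
    by rewrite !ga_mulDr IH IH'.
  by rewrite !(ga_mulDl, ga_mulDr) IH IH'.
by rewrite !ga_mulDl IH IH'.
Qed.

Lemma ga_mul1 : left_id ga_one ga_mul.
Proof.
move=> p; elim/malg_ind: p => [|c a|p q IH IH'].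
- by rewrite ga_mulC ga_mul0.
- by rewrite ga_mulUU mul1r add0r.
by rewrite ga_mulDr IH IH'.
Qed.

Lemma ga_one_neq0 : ga_one != 0.
Proof. by rewrite monalgU_eq0 oner_eq0. Qed.

HB.instance Definition _ := GRing.Zmodule_isComNzRing.Build group_algebra
  ga_mulA ga_mulC ga_mul1 ga_mulDl ga_one_neq0.

Definition ga_mono (c : K) (a : A) : group_algebra := << c *g a >>.

Lemma ga_mono1 : 1 = ga_mono 1 0. Proof. by []. Qed.

Lemma ga_monoM c a d b : ga_mono c a * ga_mono d b = ga_mono (c * d) (a + b).
Proof. exact: ga_mulUU. Qed.

Lemma ga_ind (P : group_algebra -> Prop) :
  P 0 -> (forall c a, P (ga_mono c a)) ->
  (forall x y, P x -> P y -> P (x + y)) -> forall x, P x.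
Proof. exact: malg_ind. Qed.

End GroupAlgebra.

Section Groups.
Variable G : groupType.
Local Open Scope group_scope.

Definition gen (S : set G) : {pred G} := fun x =>
  `[< forall H : {pred G}, group_closed H ->
        (forall s, S s -> s \in H) -> x \in H >].

Lemma gen_group_closed S : group_closed (gen S).
Proof.
split=> [|x y /asboolP Sx /asboolP Sy]; apply/asboolP => H clH SH.
  by case: clH.
by have [_ divH] := clH; apply: divH; [apply: Sx | apply: Sy].
Qed.

Lemma mem_gen (S : set G) s : S s -> s \in gen S.
Proof. by move=> Ss; apply/asboolP => H _; apply. Qed.

Lemma gen_min (S : set G) (H : {pred G}) : group_closed H ->
  (forall s, S s -> s \in H) -> {subset gen S <= H}.
Proof. by move=> clH SH x /asboolP; apply. Qed.

Definition finitely_generated : Prop :=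
  exists s : seq G, forall x, x \in gen [set` s].

Definition derived : {pred G} := gen [set g | exists x y, g = [~ x, y]].

Lemma derived_closed : group_closed derived.
Proof. exact: gen_group_closed. Qed.

Lemma derived1 : 1 \in derived. Proof. by case: derived_closed. Qed.
Lemma derivedF : {in derived &, forall x y, x / y \in derived}.
Proof. by case: derived_closed. Qed.
Lemma derivedV x : x \in derived -> x^-1 \in derived.
Proof. by move=> dx; rewrite -[x^-1]mul1g derivedF ?derived1. Qed.
Lemma derivedM : {in derived &, forall x y, x * y \in derived}.
Proof. by move=> x y dx dy; rewrite -[y]invgK derivedF ?derivedV. Qed.
Lemma mem_commg x y : [~ x, y] \in derived.
Proof. by apply: mem_gen; exists x, y. Qed.

Lemma derivedJ x y : x \in derived -> x ^ y \in derived.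
Proof.
move=> dx; have -> : x ^ y = x * [~ x, y] by rewrite /commg mulVKg.
by rewrite derivedM ?mem_commg.
Qed.

Definition derived_subgroup : Type := {x : G | x \in derived}.

HB.instance Definition _ := SubChoice.on derived_subgroup.
HB.instance Definition _ :=
  SubChoice_isSubGroup.Build G derived derived_subgroup derived_closed.

Definition ab_equiv (x y : G) : bool := x / y \in derived.

Fact ab_equiv_is_equiv : equiv_class_of ab_equiv.
Proof.
split=> [x|x y|y x z]; rewrite /ab_equiv.
- by rewrite mulgV derived1.
- by apply/idP/idP => /derivedV; rewrite invgF.
by move=> xy yz; have := derivedM xy yz; rewrite mulgA mulgVK.
Qed.

Canonical ab_equiv_equiv := EquivRelPack ab_equiv_is_equiv.
Canonical ab_equiv_encModRel := defaultEncModRel ab_equiv.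

(* G / [G, G], written additively. *)
Definition abelianization : Type := {eq_quot ab_equiv}.

HB.instance Definition _ := Choice.on abelianization.
HB.instance Definition _ := EqQuotient.on abelianization.

Definition abel (x : G) : abelianization := \pi_({eq_quot ab_equiv}) x.

Lemma abelP x y : abel x = abel y <-> x / y \in derived.
Proof. by split=> [/eqmodP|xy] //; apply/eqmodP. Qed.

Lemma reprabK (a : abelianization) : abel (repr a) = a. Proof. exact: reprK. Qed.

Definition ab_zero : abelianization := abel 1.
Definition ab_opp (a : abelianization) : abelianization := abel (repr a)^-1.
Definition ab_add (a b : abelianization) : abelianization :=
  abel (repr a * repr b).

Lemma abelC x y : abel (x * y) = abel (y * x).
Proof.
apply/abelP; rewrite invgM.
have -> : x * y * (x^-1 * y^-1) = [~ x^-1, y^-1].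
  by rewrite /commg /conjg !invgK !mulgA.
exact: mem_commg.
Qed.

Lemma ab_addE x y : ab_add (abel x) (abel y) = abel (x * y).
Proof.
have mul_r a b c : abel b = abel c -> abel (b * a) = abel (c * a).
  by move=> /abelP bc; apply/abelP; rewrite invgM mulgA mulgK.
rewrite /ab_add (mul_r _ _ x) ?reprabK // abelC (mul_r _ _ y) ?reprabK //.
exact: abelC.
Qed.

Fact ab_addA : associative ab_add.
Proof.
by move=> a b c; rewrite -[a]reprabK -[b]reprabK -[c]reprabK !ab_addE mulgA.
Qed.

Fact ab_addC : commutative ab_add.
Proof. by move=> a b; rewrite -[a]reprabK -[b]reprabK !ab_addE abelC. Qed.

Fact ab_add0 : left_id ab_zero ab_add.
Proof. by move=> a; rewrite -[a]reprabK ab_addE mul1g. Qed.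

Fact ab_addN : left_inverse ab_zero ab_opp ab_add.
Proof. by move=> a; rewrite -{2}[a]reprabK ab_addE mulVg. Qed.

HB.instance Definition _ := GRing.isZmodule.Build abelianization
  ab_addA ab_addC ab_add0 ab_addN.

Lemma abelM x y : abel (x * y) = (abel x + abel y)%R.
Proof. by rewrite -ab_addE. Qed.

End Groups.

Arguments finitely_generated G : clear implicits.
Arguments derived G : clear implicits.
Arguments abelianization G : clear implicits.
Arguments derived_subgroup G : clear implicits.

Lemma derived_morph (G H : groupType) (f : G -> H) :
  {morph f : x y / (x * y)%g} -> forall x, x \in derived G -> f x \in derived H.
Proof.
move=> fM x Gx; have f1 : f 1%g = 1%g.
  by apply: (@mulgI _ (f 1%g)); rewrite -fM !mulg1.
have fV y : f y^-1%g = (f y)^-1%g.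
  by apply: (@mulgI _ (f y)); rewrite -fM !mulgV f1.
pose W : {pred G} := fun x => f x \in derived H.
apply: (@gen_min G _ W _ _ x Gx) => [|_ [y [z ->]]].
  split=> [|y z Wy Wz]; first by change (f 1%g \in derived H); rewrite f1 derived1.
  by change (f (y / z)%g \in derived H); rewrite fM fV derivedF.
change (f [~ y, z]%g \in derived H).
by rewrite /commg /conjg !(fM, fV) mem_commg.
Qed.

Section Alexander.
Variable G : groupType.
Local Notation Gab := (abelianization G).

(* G'/G'', with G'' = [G', G'] taken inside the group G' *)
Definition alexander_invariant : zmodType :=
  abelianization (derived_subgroup G).
Local Notation B := alexander_invariant.

(* x |-> g x g^-1 *)
Definition derived_conj (g : G) (x : derived_subgroup G) : derived_subgroup G :=
  exist _ (val x ^ g^-1)%g (derivedJ g^-1%g (valP x)).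

Lemma derived_conjM g : {morph derived_conj g : x y / (x * y)%g}.
Proof. by move=> x y; apply: val_inj; rewrite /= conjMg. Qed.

(* (g G') . (x G'') = g x g^-1 G'' *)
Definition ab_conj (a : Gab) (b : B) : B := abel (derived_conj (repr a) (repr b)).

Lemma ab_conjE g x : ab_conj (abel g) (abel x) = abel (derived_conj g x).
Proof.
have conj_r h y z : abel y = abel z ->
    abel (derived_conj h y) = abel (derived_conj h z).
  move=> /abelP yz; apply/abelP; have := derived_morph (derived_conjM h) yz.
  have conjV : derived_conj h z^-1%g = (derived_conj h z)^-1%g.
    by apply: val_inj; rewrite /= conjVg.
  by rewrite derived_conjM conjV.
rewrite /ab_conj (conj_r _ _ x) ?reprabK //.
have /abelP dP : abel (repr (abel g)) = abel g by rewrite reprabK.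
pose d : derived_subgroup G := exist (fun y => y \in derived G) _ dP.
apply/abelP; set y := (X in X \in _).
suff -> : y = [~ d^-1, (derived_conj g x)^-1]%g by exact: mem_commg.
apply: val_inj; rewrite /= /conjg !invgK !invgM !invgK.
by rewrite !mulgA !mulgVK.
Qed.

Fact ab_conjD a : {morph ab_conj a : b b' / b + b'}.
Proof.
move=> b b'; rewrite -[a]reprabK -[b]reprabK -[b']reprabK -abelM !ab_conjE.
by rewrite derived_conjM abelM.
Qed.

Fact ab_conj0 b : ab_conj 0 b = b.
Proof.
rewrite -[b]reprabK (ab_conjE 1%g); congr abel.
by apply: val_inj; rewrite /= invg1 conjg1.
Qed.

Fact ab_conjA a a' b : ab_conj (a + a') b = ab_conj a (ab_conj a' b).
Proof.
rewrite -[a]reprabK -[a']reprabK -[b]reprabK -abelM !ab_conjE; congr abel.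
by apply: val_inj; rewrite /= invgM conjgM.
Qed.

Variable K : comNzRingType.

(* B(G) (x)_Z K, on which (c a) in K[G_ab] acts by
   (c a) . (b (x) z) = (a . b) (x) (c z) *)
Definition alexander_module : Type := tensor B K.

HB.instance Definition _ := GRing.Zmodule.on alexander_module.

Definition apure (b : B) (z : K) : alexander_module := tpure b z.

Lemma apureDl b b' z : apure (b + b') z = apure b z + apure b' z.
Proof. exact: tpureDl. Qed.

Lemma apureDr b z z' : apure b (z + z') = apure b z + apure b z'.
Proof. exact: tpureDr. Qed.

Lemma alexander_ind (P : alexander_module -> Prop) :
  (forall b z, P (apure b z)) -> (forall x, P x -> P (- x)) ->
  (forall x y, P x -> P y -> P (x + y)) -> forall x, P x.
Proof. exact: tensor_ind. Qed.

Definition ab_act (a : Gab) (c : K) : alexander_module -> alexander_module :=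
  tensor_map (ab_conj a) (fun z => c * z).

Definition alexander_scale (p : group_algebra K Gab) (x : alexander_module) :
    alexander_module :=
  fsum (fun a c => ab_act a c x) p.

Fact ab_act_pure a c b z : ab_act a c (apure b z) = apure (ab_conj a b) (c * z).
Proof. exact: (tensor_map_pure (ab_conjD a) (mulrDr c)). Qed.

Fact ab_actDr a c : {morph ab_act a c : x y / x + y}.
Proof. exact: (tensor_mapD (ab_conjD a) (mulrDr c)). Qed.

Fact ab_actN a c x : ab_act a c (- x) = - ab_act a c x.
Proof. exact: (tensor_mapN (ab_conjD a) (mulrDr c)). Qed.

Fact ab_act_is_zmod_morphism a x : zmod_morphism (fun c => ab_act a c x).
Proof.
suff D c d : ab_act a (c + d) x = ab_act a c x + ab_act a d x.
  by move=> c d; apply/eqP; rewrite eq_sym subr_eq -D subrK.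
elim/alexander_ind: x => [b z|x IH|x y IHx IHy].
- by rewrite !ab_act_pure mulrDl apureDr.
- by rewrite !ab_actN IH opprD.
rewrite (ab_actDr _ (c + d) x) (ab_actDr _ c x) (ab_actDr _ d x) IHx IHy.
exact: addrACA.
Qed.

Let F x a : {additive K -> alexander_module} :=
  HB.pack (fun c => ab_act a c x)
    (GRing.isZmodMorphism.Build K alexander_module _
       (ab_act_is_zmod_morphism a x)).

Lemma alexander_scaleU c a x :
  alexander_scale (ga_mono c a) x = ab_act a c x.
Proof. exact: (fsumU (F x)). Qed.

Lemma alexander_scaleDl x :
  {morph alexander_scale^~ x : p q / p + q}.
Proof.
pose Fx : {additive {malg K[Gab]} -> alexander_module} :=
  HB.pack (fsum (F x)) (GRing.isZmodMorphism.Build _ _ _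
    (fsum_is_zmod_morphism (F x))).
exact: (raddfD Fx).
Qed.

Lemma alexander_scale0 x : alexander_scale 0 x = 0.
Proof. by apply: (addrI (alexander_scale 0 x)); rewrite -alexander_scaleDl !addr0. Qed.

Lemma alexander_scaleDr : right_distributive alexander_scale +%R.
Proof.
move=> p x y; elim/ga_ind: p => [|c a|p q IH IH'].
- by rewrite !alexander_scale0 addr0.
- by rewrite !alexander_scaleU; apply: ab_actDr.
rewrite !(alexander_scaleDl _ p q) IH IH'; exact: addrACA.
Qed.

Lemma ab_actA a b c d x : ab_act a c (ab_act b d x) = ab_act (a + b) (c * d) x.
Proof.
elim/alexander_ind: x => [l z|x IH|x y IHx IHy].
- by rewrite !ab_act_pure ab_conjA mulrA.
- by rewrite !ab_actN IH.
rewrite (ab_actDr b d x) (ab_actDr a c (ab_act b d x)) (ab_actDr (a + b)).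
by rewrite IHx IHy.
Qed.

Lemma alexander_scaleA p q x :
  alexander_scale p (alexander_scale q x) = alexander_scale (p * q) x.
Proof.
have scaler0 r : alexander_scale r 0 = 0.
  by apply: (addrI (alexander_scale r 0)); rewrite -alexander_scaleDr !addr0.
elim/ga_ind: p => [|c a|p p' IH IH'].
- by rewrite mul0r !alexander_scale0.
- elim/ga_ind: q => [|d b|q q' IH IH'].
  + by rewrite mulr0 !alexander_scale0 scaler0.
  + by rewrite ga_monoM !alexander_scaleU ab_actA.
  by rewrite mulrDr !alexander_scaleDl alexander_scaleDr IH IH'.
by rewrite mulrDl !alexander_scaleDl IH IH'.
Qed.

Lemma alexander_scale1 : left_id 1 alexander_scale.
Proof.
move=> x; rewrite ga_mono1 alexander_scaleU.
elim/alexander_ind: x => [b z|x IH|x y IHx IHy].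
- by rewrite ab_act_pure ab_conj0 mul1r.
- by rewrite ab_actN IH.
by rewrite ab_actDr IHx IHy.
Qed.

HB.instance Definition _ :=
  GRing.Zmodule_isLmodule.Build (group_algebra K Gab) alexander_module
    alexander_scaleA alexander_scale1 alexander_scaleDr alexander_scaleDl.

End Alexander.

Section Characters.
Variables (R : realType) (G : groupType).
Local Notation C := R[i].
Local Notation Gab := (abelianization G).

(* Hom(G, C^* ) *)
Record character := Character {
  char_fun :> G -> C;
  char_neq0 : forall g, char_fun g != 0;
  charM : {morph char_fun : g h / (g * h)%g >-> g * h}
}.

Definition trivial_character : character :=
  @Character (fun=> 1) (fun=> oner_neq0 _) (fun _ _ => esym (mulr1 1)).

Variable rho : character.

Lemma char1 : rho 1%g = 1.
Proof. by apply: (mulfI (char_neq0 rho 1%g)); rewrite -charM mulg1 mulr1. Qed.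

Lemma charV g : rho g^-1%g = (rho g)^-1.
Proof.
by apply: (mulfI (char_neq0 rho g)); rewrite -charM mulgV char1 mulfV ?char_neq0.
Qed.

(* Degrees <= 2 of C_rho (x)_{Z[G]} F, where F is the bar resolution (by left
   modules) and C_rho is a right module via z . g = rho(g) z. Together with the
   action g x g^-1 on G', this convention attaches the character rho, and not
   its inverse, to the kernel of C[G_ab] -> C. *)
Definition bar_d1 : {malg C[G]} -> C^o := lext (fun g => rho g - 1 : C^o).

Definition bar_d2 : {malg C[(G * G)%type]} -> {malg C[G]} :=
  lext (fun gh => rho gh.1 *: << gh.2 >> - << (gh.1 * gh.2)%g >> + << gh.1 >>).

HB.instance Definition _ := GRing.Linear.on bar_d1.
HB.instance Definition _ := GRing.Linear.on bar_d2.

Lemma bar_d1U g : bar_d1 << g >> = rho g - 1.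
Proof. by rewrite /bar_d1 lextU scale1r. Qed.

Lemma bar_d2U c g h : bar_d2 << c *g (g, h) >> =
  c *: (rho g *: << h >> - << (g * h)%g >> + << g >>).
Proof. exact: lextU. Qed.

Lemma bar_d1d2 w : bar_d1 (bar_d2 w) = 0.
Proof.
elim/malg_ind: w => [|c [g h]|v w IHv IHw]; first by rewrite !raddf0.
  rewrite bar_d2U linearZ /= linearD linearB /= linearZ /= !bar_d1U charM.
  rewrite [X in c *: X](_ : _ = 0) ?scaler0 // /GRing.scale /=; ring.
by rewrite !raddfD /= IHv IHw addr0.
Qed.

Definition bar_cycle : {pred {malg C[G]}} := fun z => bar_d1 z == 0.

Fact bar_cycle_submod_closed : GRing.submod_closed bar_cycle.
Proof.
split=> [|a u v /eqP Zu /eqP Zv]; apply/eqP; first exact: raddf0.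
by rewrite linearP /= Zu Zv scaler0 addr0.
Qed.

Definition bar_Z1 : Type := {z : {malg C[G]} | z \in bar_cycle}.

HB.instance Definition _ := SubChoice.on bar_Z1.
HB.instance Definition _ := GRing.SubChoice_isSubLmodule.Build
  C {malg C[G]} bar_cycle bar_Z1 (GRing.submod_closed_semi bar_cycle_submod_closed).

Definition H1 : lmodType C := lquot [set z : bar_Z1 | exists w, val z = bar_d2 w].

Definition char_ab (a : Gab) : C := rho (repr a).

Lemma char_derived x : x \in derived G -> rho x = 1.
Proof.
move=> Gx; pose W : {pred G} := fun x => rho x == 1.
have cW : group_closed W.
  split=> [|y z /eqP Wy /eqP Wz]; apply/eqP; first exact: char1.
  by rewrite charM charV Wy Wz mul1r invr1.
apply/eqP; apply: (gen_min cW _ Gx) => _ [y [z ->]]; apply/eqP.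
rewrite /commg /conjg !charM !charV; field.
by rewrite !char_neq0.
Qed.

Lemma char_abE g : char_ab (abel g) = rho g.
Proof.
have /abelP dg : abel (repr (abel g)) = abel g by rewrite reprabK.
apply: (mulIf (char_neq0 rho g^-1%g)); rewrite -!charM mulgV char1.
exact: char_derived.
Qed.

Lemma char_abD a b : char_ab (a + b) = char_ab a * char_ab b.
Proof. by rewrite -[a]reprabK -[b]reprabK -abelM !char_abE charM. Qed.

Definition char_eval (p : group_algebra C Gab) : C :=
  lext (V := C^o) char_ab p.

Lemma char_evalD p q : char_eval (p + q) = char_eval p + char_eval q.
Proof. exact: raddfD. Qed.

Lemma char_eval0 : char_eval 0 = 0.
Proof. exact: raddf0. Qed.

Lemma char_evalU c a : char_eval (ga_mono c a) = c * char_ab a.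
Proof. exact: lextU. Qed.

Lemma char_eval1 : char_eval 1 = 1.
Proof.
by rewrite ga_mono1 char_evalU mul1r [char_ab 0](char_abE 1%g) char1.
Qed.

Lemma char_evalM p q : char_eval (p * q) = char_eval p * char_eval q.
Proof.
elim/ga_ind: p => [|c a|p p' IH IH'].
- by rewrite mul0r char_eval0 mul0r.
- elim/ga_ind: q => [|d b|q q' IH IH'].
  + by rewrite mulr0 char_eval0 mulr0.
  + by rewrite ga_monoM !char_evalU char_abD mulrACA.
  rewrite (mulrDr (ga_mono c a)) (char_evalD q) char_evalD IH IH'.
  exact: esym (mulrDr _ _ _).
rewrite (mulrDl p) (char_evalD p) char_evalD IH IH'.
exact: esym (mulrDl _ _ _).
Qed.

Definition char_ker : {pred group_algebra C Gab} := fun p => char_eval p == 0.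

Lemma char_ker_maximal : maximal_ideal char_ker.
Proof.
split.
  split=> [||a p q /eqP Kp /eqP Kq]; first by apply/eqP; exact: char_eval0.
    by change (char_eval 1 != 0); rewrite char_eval1 oner_neq0.
  by apply/eqP; rewrite char_evalD char_evalM Kp Kq mulr0 addr0.
move=> n [n0 n1 cl] Kn p np; apply: contraT => K'p; case/negP: n1.
have nzp : char_eval p != 0 := K'p.
pose c : group_algebra C Gab := ga_mono (char_eval p)^-1 0.
have evc : char_eval c = (char_eval p)^-1.
  by rewrite char_evalU [char_ab 0](char_abE 1%g) char1 mulr1.
have Kcp : 1 - c * p \in char_ker.
  apply/eqP; apply: (addIr (char_eval (c * p))).
  by rewrite -char_evalD subrK char_eval1 char_evalM evc mulVf ?add0r.
rewrite -[1](subrK (c * p)) addrC; apply: cl => //; exact: Kn.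
Qed.

Definition char_point : max_spec (group_algebra C Gab) :=
  MaxSpec char_ker_maximal.

End Characters.

(* dim V >= k, for a V that need not be finite-dimensional *)
Definition dim_ge (F : fieldType) (V : lmodType F) (k : nat) : Prop :=
  exists v : 'I_k -> V, forall c : 'I_k -> F,
    \sum_(i < k) c i *: v i = 0 -> forall i, c i = 0.

Definition jump_locus (R : realType) (G : groupType) (k : nat) :
    set (character R G) :=
  [set rho | dim_ge (H1 rho) k].

(* Main.v *)
From HB Require Import structures.
Require Import Defs.
From mathcomp Require Import all_boot all_order all_algebra finmap.
From mathcomp Require Import boolp classical_sets reals complex monalg ring.
(* Brings back the [span] of modules, hidden by that of vector spaces. *)
Import Defs.

(** Write [A] for the group algebra of the abelianization, [M] for the module
    [B(G) (x) C] and [m] for the kernel of evaluation at a character [rho].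
    The statement splits into a comparison in group homology and a fact of
    commutative algebra, which meet in the fibre [M / m M].

    For [rho] nontrivial, [H_1(G, C_rho)] is isomorphic to [M / m M]. The map
    sends [x (x) c], with [x] in [G'], to the class of the cycle [c [x]]; this is
    a cycle because [rho] is trivial on [G'], and conjugation by [g]
    multiplies it by [rho g], so [m M] goes to zero. To invert it, choose [t]
    with [rho t] different from [1] and send the chain [[g]] to the class of the
    commutator [t g t^-1 g^-1] in [M / m M]. This is a crossed homomorphism,
    hence kills boundaries, and both composites are multiplication by
    [rho t - 1] ([alexander_to_H1_ker], [alexander_to_H1_onto]). This explicit
    inverse takes the place of the exact sequence in low degrees of
    [G' -> G -> G_ab] and of the vanishing of [H_i(G_ab, C_rho)].

    For [M] finitely generated, [m] is in the support of the [k]-th exterior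
    power exactly when the fibre has dimension at least [k]
    ([supp_ext_power]). If the fibre has dimension [r < k], Nakayama's lemma gives
    an element [u] outside [m] that maps [M] into a submodule with [r]
    generators, whose [k]-fold wedges vanish. If [k <= r], a [k]-by-[k] determinant
    of coordinates in the fibre detects a wedge of [k] elements.

    Finite generation of [M] comes from that of [G]: [G'] is the normal closure
    of the finitely many commutators of generators ([alexander_module_fg]). *)

Set Implicit Arguments.
Unset Strict Implicit.
Import Order.TTheory GRing.Theory Num.Theory.
Local Open Scope classical_set_scope.
Local Open Scope ring_scope.
Local Open Scope quotient_scope.

(** * Spans and dimension *)

Section Combinations.
Variables (A : pzRingType) (M : lmodType A).

(** Taking for [I] the whole ring or an ideal [m] covers both the span of [y]
    and the submodule [m y_1 + .. + m y_n]. *)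
Lemma combinations_closed n (y : 'I_n -> M) (I : {pred A}) :
  (0 \in I) -> (forall a u v, u \in I -> v \in I -> a * u + v \in I) ->
  GRing.submod_closed (fun x : M =>
    `[< exists2 a : 'I_n -> A, (forall i, a i \in I) & x = \sum_i a i *: y i >]).
Proof.
move=> I0 IP; split=> [|c u v /asboolP[a Ia ->] /asboolP[b Ib ->]]; apply/asboolP.
  by exists (fun=> 0) => //; rewrite big1 // => i _; rewrite scale0r.
exists (fun i => c * a i + b i) => [i|]; first exact: IP.
rewrite scaler_sumr -big_split; apply: eq_bigr => i _ /=.
by rewrite scalerDl scalerA.
Qed.

Lemma span_range n (y : 'I_n -> M) x :
  x \in span (range y) <-> exists a : 'I_n -> A, x = \sum_i a i *: y i.
Proof.
split=> [|[a ->]]; last first.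
  by apply: rpred_sum => i _; apply: rpredZ; apply: mem_span; exists i.
have cl := @combinations_closed n y predT isT (fun _ _ _ _ _ => isT).
move/(span_min cl) => E.
suff /asboolP[a _ ->] : x \in (fun x : M =>
    `[< exists2 a : 'I_n -> A, (forall i, a i \in predT) & x = \sum_i a i *: y i >]) by exists a.
apply: E => _ [i _ <-]; apply/asboolP; exists (fun j => (i == j)%:R) => //.
rewrite (bigD1 i) //= eqxx scale1r big1 ?addr0 // => j; rewrite eq_sym.
by move/negPf->; rewrite scale0r.
Qed.

End Combinations.

Section Dimension.
Variables (F : fieldType) (V : lmodType F).

(** A spanning family of least size is free: a nontrivial relation would allow
    one of its members to be dropped. *)
Lemma basis_of_spanning n (y : 'I_n -> V) : (forall v, v \in span (range y)) ->
  exists r (e : 'I_r -> V), (forall v, v \in span (range e)) /\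
    forall c : 'I_r -> F, \sum_i c i *: e i = 0 -> forall i, c i = 0.
Proof.
move=> y_gen; pose P r := `[< exists e : 'I_r -> V, forall v, v \in span (range e) >].
have exP : exists r, P r by exists n; apply/asboolP; exists y.
case: (ex_minnP exP) => r /asboolP[e e_gen] r_min; exists r, e; split=> // c.
move=> c0 i; apply: contrapT => /eqP ci; case: r e e_gen r_min c i c0 ci => [|r].
  by move=> ? ? ? ? [].
move=> e e_gen r_min c i c0 ci; suff: P r by move/r_min; rewrite ltnn.
apply/asboolP; exists (fun j => e (lift i j)) => v.
have /span_range[a ->] := e_gen v.
have eiE : e i \in span (range (fun j => e (lift i j))).
  have -> : e i = - (c i)^-1 *: \sum_j c (lift i j) *: e (lift i j).
    move/eqP: c0; rewrite (bigD1_ord i) //= addr_eq0 => /eqP E.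
    by rewrite -[\sum_j _]opprK -E scaleNr scalerN opprK scalerA mulVf ?scale1r.
  by apply/rpredZ/rpred_sum => j _; apply/rpredZ/mem_span; exists j.
rewrite (bigD1_ord i) //= rpredD ?rpredZ //.
by apply/rpred_sum => j _; apply/rpredZ/mem_span; exists j.
Qed.

Lemma dim_ge_basis r (e : 'I_r -> V) k : (forall v, v \in span (range e)) ->
  (forall c : 'I_r -> F, \sum_i c i *: e i = 0 -> forall i, c i = 0) ->
  dim_ge V k <-> (k <= r)%N.
Proof.
move=> e_gen e_free; split=> [[v v_free]|le_kr]; last first.
  exists (fun i => e (widen_ord le_kr i)) => c c0 i.
  pose c' (j : 'I_r) := if insub (j : nat) is Some i then c i else 0.
  have c'E j : c' (widen_ord le_kr j) = c j by rewrite /c' /= valK.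
  rewrite -c'E; apply: e_free; rewrite -[RHS]c0.
  rewrite [RHS](eq_bigr (fun j => c' (widen_ord le_kr j) *: e (widen_ord le_kr j))); last first.
    by move=> j _; rewrite c'E.
  rewrite -(big_ord_narrow le_kr (F := fun j => c' j *: e j)).
  rewrite [RHS]big_mkcond /=; apply: eq_bigr => j _; case: ifP => // /negbT j_ge.
  by rewrite /c' insubN ?scale0r.
have /choice[a aE] : forall i, exists a : 'I_r -> F, v i = \sum_j a j *: e j.
  by move=> i; apply/span_range/e_gen.
rewrite leqNgt; apply/negP => lt_rk; pose X := \matrix_(i, j) a i j.
(* k > r row vectors of length r are dependent. *)
have : kermx X != 0.
  rewrite kermx_eq0 -row_leq_rank -ltnNge; exact: leq_ltn_trans (rank_leq_col X) lt_rk.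
case/rowV0Pn => w /sub_kermxP wX /negP; apply; apply/eqP/rowP => i.
rewrite mxE; apply: v_free => {i}.
under eq_bigr do rewrite aE scaler_sumr; rewrite exchange_big big1 //= => j _.
under eq_bigr do rewrite scalerA; rewrite -scaler_suml.
suff -> : \sum_i w 0 i * a i j = 0 by rewrite scale0r.
have := congr1 (fun Y : 'rV_r => Y 0 j) wX; rewrite !mxE; apply: etrans.
by apply: eq_bigr => i _; rewrite mxE.
Qed.

End Dimension.

(** * Exterior powers *)

Lemma malgUZ (K : choiceType) (S : comNzRingType) (a b : S) (k : K) :
  << a * b *g k >> = a *: << b *g k >> :> {malg S[K]}.
Proof. by apply/malgP => l; rewrite mcoeffZ !mcoeffU mulrnAr. Qed.

Section ExteriorPower.
Variables (A : comNzRingType) (M : lmodType A) (k : nat).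
Implicit Types x y : {ffun 'I_k -> M}.

Definition wedge x : ext_power M k := lproj (@ext_rel A M k) << x >>.

Lemma wedge_linear x i :
  linear (fun m => wedge (set_entry x i m) : ext_power M k).
Proof.
move=> a u v; rewrite /wedge.
have -> : lproj (@ext_rel A M k) << set_entry x i (a *: u + v) >> =
    lproj (@ext_rel A M k) (<< set_entry x i (a *: u) >> + << set_entry x i v >>).
  by apply/lprojP; rewrite opprD addrA; apply: mem_span; left; exists x, i, (a *: u), v.
rewrite raddfD; congr (_ + _); rewrite -linearZ.
by apply/lprojP; apply: mem_span; right; left; exists x, i, a, u.
Qed.

Lemma wedge_alternating x i j : i != j -> x i = x j -> wedge x = 0.
Proof.
move=> ij xij; rewrite -(raddf0 (lproj (@ext_rel A M k))); apply/lprojP.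
by rewrite subr0; apply: mem_span; right; right; exists x, i, j.
Qed.

Lemma ext_power_ind (P : ext_power M k -> Prop) :
  P 0 -> (forall a x, P (a *: wedge x)) ->
  (forall u v, P u -> P v -> P (u + v)) -> forall w, P w.
Proof.
move=> P0 PU PD w; rewrite -[w]reprlK.
elim/malg_ind: (repr w) => [|a x|p q Pp Pq]; first by rewrite raddf0.
  by rewrite -[a]mulr1 malgUZ linearZ; apply: PU.
by rewrite raddfD; apply: PD.
Qed.

Lemma set_entry_id x i : set_entry x i (x i) = x.
Proof. by apply/ffunP => j; rewrite ffunE; case: eqP => // ->. Qed.

(** Each entry in turn is moved from [S] to [span S]: for fixed other entries,
    the values of one entry that kill the wedge form a submodule. *)
Lemma wedge_span (S : set M) :
  (forall x, (forall i, S (x i)) -> wedge x = 0) ->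
  forall x, (forall i, x i \in span S) -> wedge x = 0.
Proof.
move=> S0 x xS.
(* s counts the leading entries that are only known to lie in span S. *)
suff H s : forall y, (forall i, y i \in span S) ->
    (forall i : 'I_k, (s <= i)%N -> S (y i)) -> wedge y = 0.
  by apply: (H k) => // i; rewrite leqNgt ltn_ord.
elim: s => [|s IHs] y yS yge; first by apply: S0 => i; apply: yge.
have [lt_sk|le_ks] := ltnP s k; last first.
  by apply: IHs => // i le_si; have := ltn_ord i; rewrite ltnNge (leq_trans le_ks le_si).
pose i := Ordinal lt_sk; rewrite -(set_entry_id y i).
pose W : {pred M} := fun m => wedge (set_entry y i m) == 0.
have linW := wedge_linear y i.
have W0 : wedge (set_entry y i 0) = 0.
  by have := linW (-1) 0 0; rewrite scaler0 addr0 scaleN1r addNr.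
suff : y i \in W by move/eqP.
apply: (fun clW SW => @span_min A M S W clW SW _ (yS i)) => [|m Sm]; last first.
  apply/eqP/IHs => j; rewrite ffunE; first by case: eqP => // _; apply: mem_span.
  case: eqP => // /eqP ji le_sj.
  by apply: yge; rewrite ltn_neqAle le_sj eq_sym andbT.
split=> [|a u v /eqP Wu /eqP Wv]; first exact/eqP.
by apply/eqP; rewrite linW Wu Wv scaler0 addr0.
Qed.

(** By multilinearity the entries may be taken among the [z j], and then two of
    them coincide. *)
Lemma wedge_span_lt r (z : 'I_r -> M) x :
  (r < k)%N -> (forall i, x i \in span (range z)) -> wedge x = 0.
Proof.
move=> lt_rk; apply: wedge_span => {}x xz.
have /choice[f fE] : forall i, exists j, z j = x i by move=> i; have [j _ <-] := xz i; exists j.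
have /injectivePn[i [j ij fij]] : ~~ injectiveb f.
  apply/negP => /injectiveP /leq_card; rewrite !card_ord leqNgt lt_rk //.
by apply: (wedge_alternating ij); rewrite -!fE fij.
Qed.

Lemma wedge_scale a x : wedge [ffun i => a *: x i] = a ^+ k *: wedge x.
Proof.
(* y s has its first s entries scaled. *)
pose y s : {ffun 'I_k -> M} := [ffun i : 'I_k => if (i < s)%N then a *: x i else x i].
have H s : (s <= k)%N -> wedge (y s) = a ^+ s *: wedge x.
  elim: s => [|s IHs] lt_sk.
    by rewrite scale1r; congr wedge; apply/ffunP => i; rewrite ffunE.
  pose i := Ordinal lt_sk; rewrite exprS -scalerA -IHs ?(ltnW lt_sk) //.
  have -> : y s.+1 = set_entry (y s) i (a *: x i).
    apply/ffunP => j; rewrite !ffunE ltnS leq_eqVlt -(inj_eq val_inj) /=.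
    by case: eqP => //= js; congr (_ *: x _); apply: val_inj.
  have := wedge_linear (y s) i a (x i) 0; rewrite addr0 => ->.
  have := wedge_linear (y s) i (-1) 0 0.
  rewrite scaler0 addr0 scaleN1r addNr => ->; rewrite addr0.
  congr (_ *: wedge _); apply/ffunP => j; rewrite !ffunE; case: eqP => // ->.
  by rewrite ltnn.
rewrite -H //; congr wedge; apply/ffunP => i; by rewrite !ffunE ltn_ord.
Qed.

End ExteriorPower.

(** * Support of an exterior power and the fibre *)

Lemma suppP (A : comNzRingType) (M : lmodType A) (m : max_spec A) :
  supp M m <-> exists x : M, forall u, u \notin m -> u *: x <> 0.
Proof.
split=> [[z z0]|[x x0]].
  move: z0; rewrite -[z]reprK; case: (repr z) => x s /= z0; exists x => u m'u ux0.
  apply: z0; apply/fracP; exists u => //.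
  by rewrite scaler0 subr0 /= scale1r.
exists (frac x (denom1 m)) => /fracP[u m'u]; rewrite scaler0 subr0 scale1r.
exact: x0.
Qed.

(** In this section [V] is the fibre [M / m M], presented by a surjection [pi]
    that is semilinear over the residue map [ev] and whose kernel is [m M]. *)
Section Fibre.
Variables (A : comNzRingType) (F : fieldType) (ev : {rmorphism A -> F}).
Variables (m : max_spec A) (M : lmodType A) (V : lmodType F).
Variable pi : {additive M -> V}.
Hypothesis mE : forall a, (a \in m) = (ev a == 0).
Hypothesis ev_onto : forall c, exists a, ev a = c.
Hypothesis piZ : forall a x, pi (a *: x) = ev a *: pi x.
Hypothesis pi_onto : forall v, exists x, pi x = v.
Hypothesis pi_ker : forall x, pi x = 0 ->
  x \in span [set y | exists2 a, a \in m & exists z, y = a *: z].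

(** Vectors of [V] that admit dual functionals [c] give a nonzero element of the
    localized exterior power: [det (c j (pi (x i)))] is alternating and
    [ev]-semilinear in [x], so it factors through the exterior power, and it
    sends [u *: wedge v] to [ev u], which is nonzero when [u] is outside [m]. *)
Lemma supp_ext_power_of_dual k (v : 'I_k -> M) (c : 'I_k -> V -> F) :
  (forall i, scalar (c i)) -> (forall i j, c i (pi (v j)) = (i == j)%:R) ->
  supp (ext_power M k) m.
Proof.
move=> c_lin cE; apply/suppP.
(* d is the map on formal sums of tuples induced by the determinant. *)
pose cm (x : {ffun 'I_k -> M}) := \matrix_(i, j) c j (pi (x i)).
have dZ x : zmod_morphism (fun a => ev a * \det (cm x)).
  by move=> a b; rewrite rmorphB mulrBl.
pose dadd x : {additive A -> F} := HB.pack (fun a => ev a * \det (cm x))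
  (GRing.isZmodMorphism.Build A F _ (dZ x)).
pose d : {additive {malg A[{ffun 'I_k -> M}]} -> F} := HB.pack (fsum dadd)
  (GRing.isZmodMorphism.Build _ F _ (fsum_is_zmod_morphism dadd)).
have dU a x : d << a *g x >> = ev a * \det (cm x) by exact: (fsumU dadd).
have d1 x : d << x >> = \det (cm x) by rewrite dU rmorph1 mul1r.
have dscale a p : d (a *: p) = ev a * d p.
  elim/malg_ind: p => [|b x|p q IHp IHq].
  - by rewrite scaler0 !raddf0 mulr0.
  - by rewrite -malgUZ !dU rmorphM mulrA.
  by rewrite scalerDr !raddfD IHp IHq mulrDr.
(* Taking a = b = 1 gives additivity in an entry, b = 0 scaling. *)
have det_lin x i a b y z :
    \det (cm (set_entry x i (a *: y + b *: z))) =
    ev a * \det (cm (set_entry x i y)) + ev b * \det (cm (set_entry x i z)).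
  apply: (determinant_multilinear (i0 := i)).
  - apply/rowP => j; rewrite !mxE !ffunE !eqxx raddfD /= !piZ.
    have := c_lin j (ev a) (pi y) (ev b *: pi z) => ->; congr (_ + _).
    have := c_lin j (ev b) (pi z) 0; have := c_lin j (-1) 0 0.
    by rewrite scaler0 !addr0 mulN1r addNr => -> ->; rewrite addr0.
  - apply/matrixP => i' j; rewrite !mxE !ffunE.
    by rewrite eq_sym (negPf (neq_lift i i')).
  - apply/matrixP => i' j; rewrite !mxE !ffunE.
    by rewrite eq_sym (negPf (neq_lift i i')).
pose W : {pred {malg A[{ffun 'I_k -> M}]}} := fun p => d p == 0.
have clW : GRing.submod_closed W.
  split=> [|a p q /eqP Wp /eqP Wq]; apply/eqP; first by rewrite raddf0.
  by rewrite [LHS]raddfD dscale Wp Wq mulr0 addr0.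
have relW r : ext_rel r -> r \in W.
  move=> Rr; apply/eqP; case: Rr => [[x [i [y [z ->]]]]|[[x [i [a [y ->]]]]|]].
  - rewrite !raddfB !d1; have := det_lin x i 1 1 y z.
    by rewrite !scale1r rmorph1 !mul1r => ->; ring.
  - rewrite raddfB dscale !d1; have := det_lin x i a 0 y 0.
    by rewrite scale0r addr0 rmorph0 mul0r addr0 => ->; rewrite subrr.
  case=> x [i [j [ij xij ->]]]; rewrite d1; apply: (determinant_alternate ij) => l.
  by rewrite !mxE xij.
exists (wedge [ffun i => v i]) => u m'u; rewrite /wedge -linearZ -(raddf0 (lproj _)).
move/lprojP/(span_min clW relW)/eqP; rewrite subr0 dscale d1.
have -> : cm [ffun i => v i] = 1%:M.
  by apply/matrixP => i j; rewrite !mxE ffunE cE eq_sym.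
by rewrite det1 mulr1; apply/eqP; rewrite -mE.
Qed.

Variables (n : nat) (y : 'I_n -> M).
Hypothesis y_gen : forall x, x \in span (range y).

Lemma max_spec_span x : x \in span [set y | exists2 a, a \in m & exists z, y = a *: z] ->
  exists2 a : 'I_n -> A, (forall i, a i \in m) & x = \sum_i a i *: y i.
Proof.
have cl := combinations_closed (A := A) y (max_spec0 m) (@max_specPl _ m).
move=> xm; apply/asboolP; apply: (span_min cl _ xm) => _ [a ma [z ->]]; apply/asboolP.
have /span_range[b ->] := y_gen z; exists (fun i => a * b i) => [i|].
  by have := max_specPl (b i) ma (max_spec0 m); rewrite addr0 mulrC.
by rewrite scaler_sumr; apply: eq_bigr => i _; rewrite scalerA.
Qed.

(** Nakayama's lemma without forming the localization. If the [pi (z i)] span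
    the fibre, then [y j] is congruent to an [m]-combination of the [y l] modulo
    the span of [z]; so [T y] lies in that span for a matrix [T] congruent to the
    identity modulo [m]. Multiplying by the adjugate, [det T] sends all of [M]
    into the span, and [det T] is congruent to [1]. *)
Lemma nakayama_local r (z : 'I_r -> M) : (forall v, v \in span (range (pi \o z))) ->
  exists2 u, u \notin m & forall x, u *: x \in span (range z).
Proof.
move=> z_gen.
have /choice[b bE] : forall j, exists b : 'I_n -> A,
    (forall l, b l \in m) /\ y j - \sum_l b l *: y l \in span (range z).
  move=> j; have /span_range[c cE] := z_gen (pi (y j)).
  have /choice[a aE] : forall i, exists a, ev a = c i by move=> i; apply: ev_onto.
  have /pi_ker/max_spec_span[b mb E] : pi (y j - \sum_i a i *: z i) = 0.
    rewrite raddfB raddf_sum cE; apply/eqP; rewrite subr_eq0; apply/eqP.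
    by apply: eq_bigr => i _; rewrite piZ aE.
  exists b; split=> //; rewrite -E opprB addrC subrK; apply/span_range.
  by exists a.
pose T : 'M[A]_n := 1%:M - \matrix_(j, l) b j l.
exists (\det T) => [|x].
  rewrite mE -det_map_mx; have -> : map_mx ev T = 1%:M.
    apply/matrixP => j l; rewrite !mxE rmorphB /= rmorph_nat.
    have [/(_ l)] := bE j; rewrite mE => /eqP-> _; exact: subr0.
  by rewrite det1 oner_eq0.
have Ty j : \sum_l T j l *: y l \in span (range z).
  rewrite (eq_bigr (fun l => (j == l)%:R *: y l - b j l *: y l)); last first.
    by move=> l _; rewrite !mxE scalerBl.
  rewrite sumrB (bigD1 j) //= eqxx scale1r big1 ?addr0; first by have [] := bE j.
  by move=> l; rewrite eq_sym => /negPf->; rewrite scale0r.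
have dy j : \det T *: y j \in span (range z).
  have -> : \det T *: y j = \sum_i \adj T j i *: \sum_l T i l *: y l.
    under eq_bigr do rewrite scaler_sumr.
    rewrite exchange_big /= (bigD1 j) //= [X in _ + X]big1 ?addr0.
      under eq_bigr do rewrite scalerA; rewrite -scaler_suml; congr (_ *: _).
      have := congr1 (fun X : 'M_n => X j j) (mul_adj_mx T).
      by rewrite !mxE eqxx.
    move=> l lj; under eq_bigr do rewrite scalerA; rewrite -scaler_suml.
    have := congr1 (fun X : 'M_n => X j l) (mul_adj_mx T).
    by rewrite !mxE eq_sym (negPf lj) => ->; rewrite scale0r.
  by apply: rpred_sum => i _; apply/rpredZ/Ty.
have /span_range[c ->] := y_gen x; rewrite scaler_sumr.
by apply: rpred_sum => j _; rewrite scalerA mulrC -scalerA; apply/rpredZ/dy.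
Qed.

(** Let [r] be the dimension of the fibre. If [r < k], some [u] outside [m] sends
    [M] into the span of [r] elements, hence [u ^+ k] kills the [k]-th exterior
    power. If [k <= r], the first [k] members of a basis have dual functionals. *)
Theorem supp_ext_power k : supp (ext_power M k) m <-> dim_ge V k.
Proof.
have piy_gen v : v \in span (range (pi \o y)).
  have [x <-] := pi_onto v; have /span_range[a ->] := y_gen x.
  rewrite raddf_sum; apply: rpred_sum => i _; rewrite piZ.
  by apply/rpredZ/mem_span; exists i.
have [r [e [e_gen e_free]]] := basis_of_spanning piy_gen.
rewrite (dim_ge_basis k e_gen e_free).
have /choice[z zE] : forall i, exists x, pi x = e i by move=> i; apply: pi_onto.
have ez : e = pi \o z by apply/funext => i; rewrite /= zE.
split=> [/suppP[w w0]|le_kr].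
  rewrite leqNgt; apply/negP => lt_rk.
  have [|u m'u uz] := @nakayama_local r z; first by rewrite -ez.
  have m'uk s : u ^+ s \notin m.
    by elim: s => [|s IHs]; rewrite ?expr0 ?max_spec1 // exprS max_spec_prime.
  apply: (w0 (u ^+ k)) => //.
  elim/ext_power_ind: w {w0} => [|a x|w w' IHw IHw'].
  - exact: scaler0.
  - rewrite scalerA mulrC -scalerA -wedge_scale (@wedge_span_lt _ _ _ _ z _ lt_rk) ?scaler0 //.
    by move=> i; rewrite ffunE.
  by rewrite scalerDr IHw IHw' addr0.
have /choice[c cE] : forall v, exists c : 'I_r -> F, v = \sum_i c i *: e i.
  by move=> v; apply/span_range.
have c_uniq v c' : v = \sum_i c' i *: e i -> forall i, c v i = c' i.
  move=> vE i; apply/eqP; rewrite -subr_eq0; apply/eqP.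
  apply: (e_free (fun i => c v i - c' i)); under eq_bigr do rewrite scalerBl.
  by rewrite sumrB -cE -vE subrr.
apply: (@supp_ext_power_of_dual k (fun i => z (widen_ord le_kr i))
                           (fun i v => c v (widen_ord le_kr i))) => [i a v w|i j].
  apply: (c_uniq _ (fun i => a * c v i + c w i)).
  rewrite {1}(cE v) {1}(cE w) scaler_sumr -big_split.
  by apply: eq_bigr => l _; rewrite scalerDl scalerA.
rewrite zE; apply: (c_uniq _ (fun l => (l == widen_ord le_kr j)%:R)).
rewrite (bigD1 (widen_ord le_kr j)) //= eqxx scale1r big1 ?addr0 // => l.
by move/negPf->; rewrite scale0r.
Qed.

End Fibre.

(** * Finite generation of the Alexander module *)

Section Commutators.
Variable G : groupType.
Local Open Scope group_scope.

Lemma commg_div (x a b : G) :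
  [~ x, a / b] = ([~ x, b] ^ b^-1)^-1 * [~ x, a] ^ b^-1.
Proof. by rewrite /commg /conjg !invgM !invgK !mulgA !(mulgK, mulgVK) mulgV mul1g. Qed.

Lemma invg_commg (x y : G) : [~ x, y]^-1 = [~ y, x].
Proof. by rewrite /commg /conjg !invgM !invgK !mulgA. Qed.

(** [G'] is the normal closure of the commutators of generators: modulo a normal
    [N], the elements commuting with a given element form a subgroup, so it
    is enough to test commutation on generators, in each argument in turn. *)
Lemma derived_normal_min (s : seq G) (N : {pred G}) :
  (forall x, x \in gen [set` s]) -> group_closed N ->
  (forall x g, x \in N -> x ^ g \in N) ->
  {in s &, forall x y, [~ x, y] \in N} -> {subset derived G <= N}.
Proof.
move=> s_gen clN NJ sN.
have [N1 Nd] := clN.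
have NV x : x \in N -> x^-1 \in N by move=> Nx; rewrite -[_^-1]mul1g Nd.
have NM x y : x \in N -> y \in N -> x * y \in N.
  by move=> Nx Ny; rewrite -[y]invgK Nd ?NV.
have cent x : (forall y, y \in s -> [~ x, y] \in N) -> forall y, [~ x, y] \in N.
  move=> xs y; pose W : {pred G} := fun y => [~ x, y] \in N.
  apply: (@gen_min G [set` s] W _ xs y (s_gen y)).
  split=> [|a b Wa Wb]; first by change ([~ x, 1] \in N); rewrite commg1.
  by change ([~ x, a / b] \in N); rewrite commg_div NM ?NV ?NJ.
apply: gen_min => // _ [x [y ->]]; apply: (cent) => {}y ys.
rewrite -invg_commg; apply/NV/cent => {}x xs; exact: sN.
Qed.

End Commutators.

Section AlexanderModule.
Variables (K : comNzRingType) (G : groupType).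
Local Notation A := (group_algebra K (abelianization G)).
Local Notation M := (alexander_module G K).

Definition dclass (x : derived_subgroup G) : M := apure (abel x) 1.

Lemma apureZ (b : alexander_invariant G) (c d : K) :
  apure b (c * d) = (ga_mono c 0 : A) *: (apure b d : M).
Proof. by rewrite /GRing.scale /= alexander_scaleU ab_act_pure ab_conj0. Qed.

Lemma apureE (x : derived_subgroup G) (c : K) :
  apure (abel x) c = (ga_mono c 0 : A) *: dclass x :> M.
Proof. by rewrite -apureZ mulr1. Qed.

Lemma apureJ g (x : derived_subgroup G) (c : K) :
  apure (abel (derived_conj g x)) c =
  (ga_mono 1 (abel g) : A) *: (apure (abel x) c : M).
Proof. by rewrite /GRing.scale /= alexander_scaleU ab_act_pure ab_conjE mul1r. Qed.

Lemma apure_0l (c : K) : apure (0 : alexander_invariant G) c = 0 :> M.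
Proof. by apply: (addrI (apure 0 c)); rewrite -apureDl !addr0. Qed.

Lemma apureB x y (c : K) :
  apure (abel (x / y)%g) c = apure (abel x) c - apure (abel y) c :> M.
Proof. by apply/eqP; rewrite eq_sym subr_eq -apureDl -abelM mulgVK. Qed.

Definition commutator (x y : G) : derived_subgroup G :=
  exist _ [~ x, y]%g (mem_commg x y).

(** The elements of [G'] whose class lies in the span of the classes of
    commutators of generators form a normal subgroup of [G], because
    conjugation acts on the module through scalars. *)
Lemma alexander_module_fg : finitely_generated G ->
  exists n (y : 'I_n -> M), forall x, x \in span (range y).
Proof.
case=> s s_gen; pose l := [seq dclass (commutator x y) | x <- s, y <- s].
pose Y (i : 'I_(size l)) := l`_i.
have lY z : z \in l -> z \in span (range Y).
  by case/(nthP 0) => i lt_i <-; apply: mem_span; exists (Ordinal lt_i).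
exists (size l), Y.
pose N : {pred G} := fun x => `[< exists2 d : derived_subgroup G,
  val d = x & dclass d \in span (range Y) >].
have dN : {subset derived G <= N}.
  apply: (derived_normal_min s_gen) => [|x g|x y xs ys]; last 1 first.
  - apply/asboolP; exists (commutator x y) => //; apply: lY.
    by apply/allpairsP; exists (x, y).
  - split=> [|_ _ /asboolP[x <- xY] /asboolP[y <- yY]]; apply/asboolP.
      by exists 1%g; rewrite // /dclass apure_0l rpred0.
    exists (x / y)%g; first by [].
    by rewrite /dclass apureB; apply: (rpredB xY yY).
  move=> /asboolP[d <- dY]; apply/asboolP; exists (derived_conj g^-1 d).
    by rewrite /= invgK.
  by rewrite /dclass apureJ rpredZ.
elim/alexander_ind => [b z|x|x y]; [|exact: rpredNr|exact: rpredD].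
rewrite -[b]reprabK apureE rpredZ //.
have /asboolP[d /val_inj <-//] := dN _ (valP (repr b)).
Qed.

End AlexanderModule.

(** * The comparison of first homology with the fibre *)

Lemma tensor_universal (A B V : zmodType) (f : A -> B -> V) :
  (forall a, {morph f a : b b' / b + b'}) ->
  (forall b, {morph f^~ b : a a' / a + a'}) ->
  exists h : {additive tensor A B -> V}, forall a b, h (tpure a b) = f a b.
Proof.
move=> fDr fDl.
have FB k : zmod_morphism (fun n : int => f k.1 k.2 *~ n).
  by move=> n n'; rewrite mulrzBr.
pose F k : {additive int -> V} := HB.pack (fun n : int => f k.1 k.2 *~ n)
  (GRing.isZmodMorphism.Build int V _ (FB k)).
pose g : {additive {malg int[(A * B)%type]} -> V} := HB.pack (fsum F)
  (GRing.isZmodMorphism.Build _ V _ (fsum_is_zmod_morphism F)).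
have g1 a b : g << (a, b) >> = f a b by apply: etrans (fsumU F _ _) _; rewrite /= mulr1z.
pose W : {pred {malg int[(A * B)%type]}} := fun p => g p == 0.
have gZ n p : g (n *: p) = g p *~ n.
  elim/malg_ind: p => [|m k|p q IHp IHq].
  - by rewrite scaler0 !raddf0 mul0rz.
  - by rewrite -malgUZ ![g _](fsumU F) /= mulrC mulrzA.
  by rewrite scalerDr !raddfD IHp IHq mulrzDl.
have clW : GRing.submod_closed W.
  split=> [|a p q /eqP Wp /eqP Wq]; apply/eqP; first by rewrite raddf0.
  by rewrite [LHS]raddfD gZ Wp Wq mul0rz addr0.
have relW r : tensor_rel r -> r \in W.
  by case=> [[a [a' [b ->]]]|[a [b [b' ->]]]]; apply/eqP;
    rewrite !raddfB !g1 ?fDl ?fDr -addrA -opprD subrr.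
have hB : zmod_morphism (fun x : tensor A B => g (repr x)).
  move=> x y; apply/eqP; rewrite -subr_eq0 -!raddfB.
  apply/(span_min clW relW)/lprojP; rewrite [RHS]raddfB; apply: etrans (reprlK _) _.
  by congr (_ - _); apply: esym; apply: reprlK.
pose h : {additive tensor A B -> V} := HB.pack (fun x : tensor A B => g (repr x))
  (GRing.isZmodMorphism.Build _ V _ hB).
exists h => a b; change (g (repr (tpure a b)) = f a b).
rewrite -g1; apply/eqP; rewrite -subr_eq0 -raddfB.
by apply/(span_min clW relW)/lprojP; apply: reprlK.
Qed.

Section BarHomology.
Variables (R : realType) (G : groupType) (rho : character R G).
Local Notation C := R[i].
Local Notation A := (group_algebra C (abelianization G)).
Local Notation M := (alexander_module G C).
Local Notation m := (char_point rho).

Fact char_eval_is_zmod_morphism : zmod_morphism (char_eval rho).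
Proof. exact: raddfB. Qed.
HB.instance Definition _ :=
  GRing.isZmodMorphism.Build A C (char_eval rho) char_eval_is_zmod_morphism.
Fact char_eval_is_monoid_morphism : monoid_morphism (char_eval rho).
Proof. split; [exact: char_eval1|exact: char_evalM]. Qed.
HB.instance Definition _ :=
  GRing.isMonoidMorphism.Build A C (char_eval rho) char_eval_is_monoid_morphism.

Lemma char_eval_onto c : exists a, char_eval rho a = c.
Proof.
by exists (ga_mono c 0); rewrite char_evalU [char_ab _ 0](char_abE rho 1%g) char1 mulr1.
Qed.

(** The cokernel of [bar_d2], that is, 1-chains modulo 1-boundaries. It contains
    [H1] as the kernel of the map induced by [bar_d1], and computations are
    simpler in it because chains need not be cycles. *)
Definition crossed_target : lmodType C := lquot (range (bar_d2 rho)).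

Definition bar_class : {linear {malg C[G]} -> crossed_target} :=
  lproj (range (bar_d2 rho)).

Definition delta (g : G) : crossed_target := bar_class << g >>.

Lemma bar_class_eq0 z : bar_class z = 0 <-> exists w, z = bar_d2 rho w.
Proof.
split=> [|[w ->]]; last first.
  rewrite -(raddf0 bar_class); apply/lprojP; rewrite subr0; apply: mem_span.
  by exists w.
rewrite -(raddf0 bar_class) => /lprojP; rewrite subr0.
pose W : {pred {malg C[G]}} := fun z => `[< exists w, z = bar_d2 rho w >].
have clW : GRing.submod_closed W.
  split=> [|a p q /asboolP[x ->] /asboolP[y ->]]; apply/asboolP.
    by exists 0; rewrite raddf0.
  by exists (a *: x + y); rewrite linearP.
move/(span_min clW) => H; apply/asboolP/H => _ [w _ <-].
by apply/asboolP; exists w.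
Qed.

Lemma bar_classU c g : bar_class << c *g g >> = c *: delta g.
Proof. by rewrite -linearZZ -malgUZ mulr1. Qed.

(** [delta] is the universal crossed homomorphism: this relation is what the
    boundary of [(g, h)] says. *)
Lemma deltaM g h : delta (g * h)%g = delta g + rho g *: delta h.
Proof.
have : bar_class (bar_d2 rho << (g, h) >>) = 0 by apply/bar_class_eq0; exists << (g, h) >>.
rewrite bar_d2U scale1r linearD linearB linearZZ addrAC => /eqP.
by rewrite subr_eq0 addrC => /eqP.
Qed.

Definition H1class : {linear bar_Z1 rho -> H1 rho} :=
  lproj [set z : bar_Z1 rho | exists w, val z = bar_d2 rho w].

Lemma bar_class_valD (u v : bar_Z1 rho) :
  bar_class (val (u + v)) = bar_class (val u) + bar_class (val v).
Proof. exact: (raddfD bar_class (val u) (val v)). Qed.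

Lemma bar_class_valZ a (u : bar_Z1 rho) : bar_class (val (a *: u)) = a *: bar_class (val u).
Proof. exact: (linearZZ bar_class a (val u)). Qed.

Lemma H1classP (u v : bar_Z1 rho) :
  H1class u = H1class v <-> bar_class (val u) = bar_class (val v).
Proof.
split=> [/lprojP uv|uv].
  pose W : {pred bar_Z1 rho} := fun z => bar_class (val z) == 0.
  have clW : GRing.submod_closed W.
    split=> [|a p q /eqP Wp /eqP Wq]; apply/eqP; first by rewrite !raddf0.
    by rewrite !linearP /= Wp Wq scaler0 addr0.
  apply/eqP; rewrite -subr_eq0 -!raddfB; apply: (span_min clW _ uv) => s [w sw].
  by apply/eqP/bar_class_eq0; exists w.
apply/lprojP/mem_span/bar_class_eq0.
by rewrite -scaleN1r bar_class_valD bar_class_valZ uv scaleN1r subrr.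
Qed.

Fact bar_cycle_derived (x : derived_subgroup G) c : << c *g val x >> \in bar_cycle rho.
Proof.
by apply/eqP; rewrite /bar_d1 lextU (char_derived rho (valP x)) subrr scaler0.
Qed.

Definition derived_cycle x c : bar_Z1 rho :=
  exist (fun z => z \in bar_cycle rho) _ (bar_cycle_derived x c).

Lemma bar_class_derived x c : bar_class (val (derived_cycle x c)) = c *: delta (val x).
Proof. exact: bar_classU. Qed.

Local Notation cycle_class x c := (H1class (derived_cycle x c)).

Lemma derived_cycleM x y c : cycle_class (x * y)%g c = cycle_class x c + cycle_class y c.
Proof.
rewrite -raddfD; apply/H1classP; rewrite bar_class_valD !bar_class_derived deltaM.
by rewrite (char_derived rho (valP x)) scale1r scalerDr.
Qed.

Lemma derived_cycleD x c d : cycle_class x (c + d) = cycle_class x c + cycle_class x d.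
Proof. by rewrite -raddfD; apply/H1classP; rewrite bar_class_valD !bar_class_derived scalerDl. Qed.

Lemma derived_cycleZ x c d : cycle_class x (c * d) = c *: cycle_class x d.
Proof.
rewrite -(linearZZ H1class c (derived_cycle x d)); apply/H1classP.
by rewrite bar_class_valZ !bar_class_derived scalerA.
Qed.

(** Expand [delta] on the two sides of [g x = (g x g^-1) g]. *)
Lemma derived_cycleJ g x c : cycle_class (derived_conj g x) c = rho g *: cycle_class x c.
Proof.
rewrite -linearZZ; apply/H1classP; rewrite bar_class_valZ !bar_class_derived.
suff -> : delta (val (derived_conj g x)) = rho g *: delta (val x).
  by rewrite !scalerA mulrC.
apply: (addIr (delta g)); rewrite [RHS]addrC -deltaM.
have -> : (g * val x = val (derived_conj g x) * g)%g.
  by rewrite /= /conjg invgK !mulgA mulgVK.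
by rewrite (deltaM (val _) g) (char_derived rho (valP (derived_conj g x))) scale1r.
Qed.

(** On [G'], where [rho] is trivial, the class is additive in [x], so it kills
    [G''] and descends to [G' / G'']. *)
Lemma derived_cycle_abel x y c : abel x = abel y -> cycle_class x c = cycle_class y c.
Proof.
have cB a b : cycle_class (a / b)%g c = cycle_class a c - cycle_class b c.
  by apply/eqP; rewrite eq_sym subr_eq -derived_cycleM mulgVK.
move=> /abelP xy; apply/eqP; rewrite -subr_eq0 -cB.
pose W : {pred derived_subgroup G} := fun z => cycle_class z c == 0.
have c1 : cycle_class 1%g c = 0.
  by rewrite -[1%g](mulgV 1%g) cB subrr.
have clW : group_closed W.
  split=> [|a b /eqP Wa /eqP Wb]; apply/eqP => //.
  by rewrite cB Wa Wb subrr.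
apply: (gen_min clW _ xy) => _ [a [b ->]]; apply/eqP.
have cV a' : cycle_class a'^-1%g c = - cycle_class a' c by rewrite -[_^-1%g]mul1g cB c1 sub0r.
rewrite (derived_cycleM a^-1%g (b^-1 * (a * b))%g) (derived_cycleM b^-1%g (a * b)%g).
by rewrite (derived_cycleM a b) (cV a) (cV b) addrCA addKr addNr.
Qed.

(** The comparison map, [x (x) c |-> c [x]] for [x] in [G']. *)
Lemma alexander_to_H1 : exists pi : {additive M -> H1 rho},
  forall x c, pi (apure (abel x) c) = cycle_class x c.
Proof.
pose f (b : alexander_invariant G) c := cycle_class (repr b) c.
have fDr b : {morph f b : c d / c + d} by move=> c d; apply: derived_cycleD.
have fDl c : {morph f^~ c : b b' / b + b'}.
  move=> b b'; rewrite /f -derived_cycleM; apply: derived_cycle_abel.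
  by rewrite abelM !reprabK.
have [pi piE] := tensor_universal fDr fDl.
exists pi => x c; rewrite [LHS]piE; apply: derived_cycle_abel; exact: reprabK.
Qed.

Variable pi : {additive M -> H1 rho}.
Hypothesis piE : forall x c, pi (apure (abel x) c) = cycle_class x c.

Lemma alexander_to_H1Z a x : pi (a *: x) = char_eval rho a *: pi x.
Proof.
elim/ga_ind: a => [|c a|p q IHp IHq].
- by rewrite scale0r raddf0 char_eval0 scale0r.
- elim/alexander_ind: x => [b z|x IH|x y IHx IHy].
  + rewrite -[a]reprabK -[b]reprabK; move: (repr a) (repr b) => g x.
    rewrite [_ *: _]alexander_scaleU ab_act_pure ab_conjE.
    apply: etrans (piE _ _) _; have -> : pi (apure (abel x) z) = cycle_class x z := piE x z.
    by rewrite char_evalU char_abE derived_cycleJ derived_cycleZ scalerA mulrC.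
  + by rewrite scalerN !raddfN IH.
  have -> : ga_mono c a *: (x + y) = ga_mono c a *: x + ga_mono c a *: y :> M.
    exact: scalerDr.
  by rewrite [LHS]raddfD [pi (x + y)]raddfD IHx IHy scalerDr.
by rewrite scalerDl [LHS]raddfD IHp IHq char_evalD scalerDl.
Qed.

Variable t : G.
Hypothesis t1 : rho t != 1.

(** This is [t g t^-1 g^-1], as [[~ x, y]] stands for [x^-1 y^-1 x y]. *)
Definition tcomm (g : G) : derived_subgroup G := commutator t^-1%g g^-1%g.

Fact apure_is_zmod_morphism (b : alexander_invariant G) :
  zmod_morphism (fun c : C => apure b c).
Proof. by move=> c d; apply/eqP; rewrite eq_sym subr_eq -apureDr subrK. Qed.

Let F g : {additive C -> M} := HB.pack (fun c : C => apure (abel (tcomm g)) c)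
  (GRing.isZmodMorphism.Build C M _ (apure_is_zmod_morphism (abel (tcomm g)))).

(** [<< c *g g >> |-> tcomm g (x) c]. On cycles and modulo [m M], this is
    [rho t - 1] times an inverse of the comparison map. *)
Definition bar_lift : {additive {malg C[G]} -> M} :=
  HB.pack (fsum F) (GRing.isZmodMorphism.Build _ M _ (fsum_is_zmod_morphism F)).

Lemma bar_liftU c g : bar_lift << c *g g >> = apure (abel (tcomm g)) c.
Proof. exact: (fsumU F). Qed.

Lemma tcommM g h : tcomm (g * h)%g = (tcomm g * derived_conj g (tcomm h))%g.
Proof.
apply: val_inj; rewrite /= /commg /conjg !invgM !invgK !mulgA.
by rewrite !(mulgK, mulgVK).
Qed.

Lemma tcomm_derived x : tcomm (val x) = (derived_conj t x / x)%g.
Proof. by apply: val_inj; rewrite /= /commg /conjg !invgK !mulgA. Qed.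

(** A set of generators of [m M]. *)
Definition char_ker_mul := [set y : M | exists2 a, a \in m & exists z, y = a *: z].

(** [tcomm] satisfies a crossed product rule, [tcommM]; modulo [m M], where
    [abel g] acts as [rho g], it becomes the relation of [deltaM]. *)
Lemma bar_lift_boundary w : bar_lift (bar_d2 rho w) \in span char_ker_mul.
Proof.
elim/malg_ind: w => [|c [g h]|v w IHv IHw]; first by rewrite !raddf0 rpred0.
  have -> : bar_d2 rho << c *g (g, h) >> =
      << c * rho g *g h >> - << c *g (g * h)%g >> + << c *g g >>.
    have E k : << c *g k >> = c *: << k >> :> {malg C[G]} by rewrite -malgUZ mulr1.
    rewrite (bar_d2U rho c g h).
    rewrite mulrC malgUZ (E h) (E g) (E (g * h)%g) scalerDr scalerBr.
    by rewrite !scalerA mulrC.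
  rewrite raddfD raddfB !bar_liftU.
  have -> : apure (abel (tcomm (g * h)%g)) c =
      apure (abel (tcomm g)) c + (ga_mono 1 (abel g) : A) *: (apure (abel (tcomm h)) c : M).
    by rewrite tcommM abelM apureDl apureJ.
  rewrite mulrC apureZ; move: (apure _ _) (apure _ _) => y x.
  rewrite [y + _]addrC opprD addrA subrK -scalerBl.
  apply: mem_span; exists (ga_mono (rho g) 0 - ga_mono 1 (abel g)); last by exists x.
  apply/eqP; rewrite rmorphB /= !char_evalU [char_ab _ 0](char_abE rho 1%g) char1.
  by rewrite char_abE mulr1 mul1r subrr.
by rewrite !raddfD rpredD.
Qed.

(** For [x] in [G'], [t x t^-1 x^-1] is the translate of [x] by [t] minus [x];
    hence [bar_lift] after the comparison map is multiplication by [t - 1]. *)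
Lemma bar_lift_cycle x : exists2 z : bar_Z1 rho,
  pi x = H1class z & bar_lift (val z) = (ga_mono 1 (abel t) - 1) *: x.
Proof.
elim/alexander_ind: x => [b c|x [z pz lz]|x y [z pz lz] [z' pz' lz']].
- rewrite -[b]reprabK; move: (repr b) => d; exists (derived_cycle d c); first exact: piE.
  apply: etrans (bar_liftU _ _) _; rewrite tcomm_derived apureB apureJ.
  by rewrite scalerBl scale1r.
- exists (- z); first by rewrite [LHS]raddfN pz; apply: esym (raddfN H1class z).
  by apply: etrans (raddfN bar_lift (val z)) _; rewrite lz -scalerN.
exists (z + z'); first by rewrite [LHS]raddfD pz pz'; apply: esym (raddfD H1class z z').
apply: etrans (raddfD bar_lift (val z) (val z')) _; rewrite lz lz'.
by apply: esym; apply: scalerDr.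
Qed.

(** By the two previous lemmas [(t - 1) x] lies in [m M], and [t - 1] is
    invertible modulo [m] because [rho t] is not [1]. *)
Lemma alexander_to_H1_ker x : pi x = 0 -> x \in span char_ker_mul.
Proof.
have [z -> lz] := bar_lift_cycle x.
rewrite -(raddf0 H1class) => /H1classP; rewrite !raddf0 => /bar_class_eq0[w zw].
have := bar_lift_boundary w; rewrite -zw lz; set u := (_ - 1) => ux.
have evu : char_eval rho u = rho t - 1.
  by rewrite raddfB /= char_evalU char_abE mul1r rmorph1.
have [c cE] := char_eval_onto (rho t - 1)^-1.
rewrite -[x](subrK (c *: (u *: x))); apply: rpredD; last by apply: (rpredZ c) ux.
rewrite scalerA -{1}[x]scale1r -scalerBl; apply: mem_span; exists (1 - c * u); last by exists x.
apply/eqP; rewrite rmorphB rmorphM rmorph1 /= cE evu mulVf ?subrr //.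
by rewrite subr_eq0.
Qed.

(** Expand [delta] on the two sides of [(t g t^-1 g^-1) (g t) = t g]. *)
Lemma delta_tcomm g :
  delta (val (tcomm g)) = (rho t - 1) *: delta g - (rho g - 1) *: delta t.
Proof.
have E : (val (tcomm g) * (g * t) = t * g)%g.
  by rewrite /= /commg /conjg !invgK !mulgA !mulgVK.
have := deltaM (val (tcomm g)) (g * t)%g.
rewrite E (deltaM t g) (deltaM g t) (char_derived rho (valP (tcomm g))) scale1r.
move: (delta (val (tcomm g))) (delta g) (delta t) => u v w.
move=> E'; apply: (addIr (v + rho g *: w)); rewrite -E' !scalerBl !scale1r opprB.
by rewrite addrACA !subrK addrC.
Qed.

(** The correction term in [delta t] vanishes when [z] is a cycle, which gives
    the surjectivity of the comparison map. It is kept because the induction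
    on [z] passes through chains that are not cycles. *)
Lemma bar_lift_section z : exists2 u : bar_Z1 rho,
  pi (bar_lift z) = H1class u &
  bar_class (val u) = (rho t - 1) *: bar_class z - bar_d1 rho z *: delta t.
Proof.
elim/malg_ind: z => [|c g|z z' [u pu uz] [u' pu' uz']].
- exists 0; first by rewrite !raddf0.
  by rewrite !raddf0 scale0r subrr.
- exists (derived_cycle (tcomm g) c); first by rewrite bar_liftU piE.
  have -> : bar_d1 rho << c *g g >> = c * (rho g - 1) by apply: lextU.
  rewrite bar_class_derived delta_tcomm bar_classU.
  move: (rho t - 1) (rho g - 1) (delta g) (delta t) => a b u v.
  by rewrite scalerBr !scalerA [c * a]mulrC.
exists (u + u'); first by rewrite !raddfD pu pu'.
rewrite bar_class_valD !raddfD uz uz' (scalerDl (delta t) (bar_d1 rho z)) opprD.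
exact: addrACA.
Qed.

Lemma alexander_to_H1_onto v : exists x, pi x = v.
Proof.
pose z : bar_Z1 rho := (rho t - 1)^-1 *: repr v.
exists (bar_lift (val z)); have [u -> uw] := bar_lift_section (val z).
rewrite -[v]reprlK; apply/H1classP; rewrite uw.
have /eqP -> := valP z; rewrite scale0r subr0 bar_class_valZ scalerA mulfV ?scale1r //.
by rewrite subr_eq0.
Qed.

End BarHomology.

(** * Jump loci and supports *)

Lemma nontrivial_characterP (R : realType) (G : groupType) (rho : character R G) :
  rho <> trivial_character R G -> exists t, rho t != 1.
Proof.
move=> nt; apply: contrapT => all1; apply: nt.
have {all1} rho1 : char_fun rho = (fun=> 1).
  by apply/funext => g; apply/eqP/negP => g1; apply: all1; exists g; apply/negP.
case: rho rho1 => f f0 fM /= fE; subst f.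
by congr Character; apply: Prop_irrelevance.
Qed.

Theorem theorem12p6 (R : realType) (G : groupType)
    (hG : finitely_generated G) (k : nat) (hk : (1 <= k)%N) :
  @jump_locus R G k `\ trivial_character R G =
  (@char_point R G) @^-1`
    supp (ext_power (alexander_module G R[i]) k) `\ trivial_character R G.
Proof.
suff E rho : rho <> trivial_character R G ->
    supp (ext_power (alexander_module G R[i]) k) (char_point rho) <->
    dim_ge (H1 rho) k.
  by apply/seteqP; split=> rho [Vrho /= nt]; split=> //; apply/E.
move=> /nontrivial_characterP[t t1].
have [pi piE] := alexander_to_H1 rho.
have [n [y y_gen]] := alexander_module_fg R[i] hG.
apply: (@supp_ext_power _ _ (char_eval rho) _ _ _ pi _ _ _ _ _ n y) => //.
- exact: char_eval_onto.
- exact: alexander_to_H1Z.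
- exact: alexander_to_H1_onto t1.
- exact: alexander_to_H1_ker t1.
Qed.
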